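(* Let $\varphi$ be a bounded, Riemann integrable function defined on an interval $I=[a,b]$, and let $\Phi$ be an indefinite integral of $\varphi$ on $I$. Let $\psi$ be a bounded, Riemann integrable function defined on $\Phi(I)$, the range of $\Phi$, that does not change sign on $\Phi(I)$, and let $\Psi$ be an indefinite integral of $\psi$. Let $f$ be a bounded function defined on $\Phi(I)$. Then $f$ is Riemann integrable with respect to $\Psi$ on $\Phi(I)$ if and only if the function $x\mapsto f(\Phi(x))\,\psi(\Phi(x))$ is Riemann integrable with respect to $\Phi$ on $I$, and in that case, with the oriented interval $\mathcal I=[\Phi(a),\Phi(b)]$, $$\int_{\mathcal I} f\, d\Psi=\int_I f(\Phi)\,\psi(\Phi)\, d\Phi .$$
   Context: $I=[a,b]$ is a closed finite interval of $\mathbb{R}$; all functions are real valued. A function does not change sign if it is everywhere $\ge 0$ or everywhere $\le 0$ on its domain. That $\Phi$ is an indefinite integral of $\varphi$ on $I$ means $\Phi(x)=\Phi(a)+\int_a^x\varphi$ for all $x\in I$, with $\Phi(a)\in\mathbb{R}$ arbitrary; $\Phi$ is continuous, so $\Phi(I)$ is a closed bounded interval (possibly a single point), but $\Phi(a),\Phi(b)$ need not be its endpoints and $\Phi$ need not be monotone. That $\Psi$ is an indefinite integral of $\psi$ on $\Phi(I)$ means $\Psi(y)=\Psi(\Phi(a))+\int_{\Phi(a)}^{y}\psi$ for all $y\in\Phi(I)$, where the Riemann integral is oriented ($\int_s^t=-\int_t^s$). The notation $f(\Phi)$ means $f\circ\Phi$, and $\psi(\Phi)$ means $\psi\circ\Phi$.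 Integrability with respect to an integrator: let $c\le d$, let $g$ be a bounded function on $[c,d]$ and $\Theta$ a function on $[c,d]$. Then $g$ is Riemann integrable with respect to $\Theta$ on $[c,d]$, with integral $\int_{[c,d]}g\,d\Theta=A\in\mathbb{R}$, if for every $\varepsilon>0$ there is a partition $\mathcal P_\varepsilon$ of $[c,d]$ such that for every partition $c=x_0\le x_1\le\dots\le x_n=d$ refining $\mathcal P_\varepsilon$ and all $\xi_k\in[x_{k-1},x_k]$ one has $\big|\sum_{k=1}^n g(\xi_k)(\Theta(x_k)-\Theta(x_{k-1}))-A\big|\le\varepsilon$. When $\Theta$ is continuous and increasing this is equivalent to $U(g,\Theta)=L(g,\Theta)$, with $A$ the common value, where $U(g,\Theta)=\inf_{\mathcal P}\sum_k(\sup_{[x_{k-1},x_k]}g)(\Theta(x_k)-\Theta(x_{k-1}))$ and $L(g,\Theta)=\sup_{\mathcal P}\sum_k(\inf_{[x_{k-1},x_k]}g)(\Theta(x_k)-\Theta(x_{k-1}))$. If $c=d$, every $g$ is integrable with integral $0$. Integrals are oriented: if $\Phi(a)>\Phi(b)$, then $\int_{[\Phi(a),\Phi(b)]}f\,d\Psi=-\int_{[\Phi(b),\Phi(a)]}f\,d\Psi$. *)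

(* Defs.v *)
From Stdlib Require Import Reals List.
From mathcomp Require Import ssreflect seq.
From Coquelicot Require Import Coquelicot.

Open Scope R_scope.

Definition bounded_on (c d : R) (g : R -> R) : Prop :=
  exists M : R, forall x : R, c <= x <= d -> Rabs (g x) <= M.

Definition no_sign_change_on (c d : R) (g : R -> R) : Prop :=
  (forall x : R, c <= x <= d -> 0 <= g x) \/
  (forall x : R, c <= x <= d -> g x <= 0).

(* The base point [s] need not be an endpoint of [[c, d]]: [RInt] is oriented,
   so [x < s] is allowed. *)
Definition indefinite_integral (c d s : R) (g G : R -> R) : Prop :=
  forall x : R, c <= x <= d -> G x = G s + RInt g s x.

(* The list of division points x_0 <= x_1 <= ... <= x_n, with x_0 = c and
   x_n = d ([last c t] is the last element of [c :: t]). *)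
Definition is_partition (c d : R) (P : list R) : Prop :=
  exists t : list R, P = c :: t /\ last c t = d /\ sorted Rle P.

(* Coquelicot's [Riemann_sum] with the increments of [Theta] in place of those
   of the identity. In [SF_t] each x_k is paired with its tag xi_k in
   [[x_{k-1}, x_k]]; the second component of the initial pair is never used. *)
Definition RS_sum (g Theta : R -> R) (ptd : @SF_seq R) : R :=
  foldr Rplus 0
    (pairmap (fun x y : R * R => g (snd y) * (Theta (fst y) - Theta (fst x)))
       (SF_h ptd, 0) (SF_t ptd)).

(* Convergence along refinement of partitions, not as the mesh tends to 0. *)
Definition is_RSInt (g Theta : R -> R) (c d A : R) : Prop :=
  forall eps : R, 0 < eps ->
  exists P : list R, is_partition c d P /\
    forall ptd : @SF_seq R,
      is_partition c d (SF_lx ptd) -> pointed_subdiv ptd ->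
      incl P (SF_lx ptd) ->
      Rabs (RS_sum g Theta ptd - A) <= eps.

Definition ex_RSInt (g Theta : R -> R) (c d : R) : Prop :=
  exists A : R, is_RSInt g Theta c d A.

Definition is_RSInt_oriented (g Theta : R -> R) (s t A : R) : Prop :=
  (s <= t /\ is_RSInt g Theta s t A) \/
  (t < s /\ is_RSInt g Theta t s (- A)).

(* Main.v *)
Require Import Defs.
From Stdlib Require Import Reals Lra Classical List.
From mathcomp Require Import ssreflect seq.
From Coquelicot Require Import Coquelicot.
Open Scope R_scope.

(** Put h = f psi. On a cell where psi oscillates by at most w, the increment
    of Psi differs from psi(xi) times the length of the cell by at most w times
    that length, so the sums of f against Psi and the Riemann sums of h agree in
    the limit ([fine_RS_sum_density]); hence f is integrable against Psi exactly
    when h is Riemann integrable. The same remark applied to phi turns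
    integrability of h(Phi) against Phi into Riemann integrability of h(Phi) phi.
    What remains is the change of variable theorem of Kestelman and its converse
    by Preiss and Uher: for h bounded, h is Riemann integrable on Phi(I) if and
    only if h(Phi) phi is Riemann integrable on I, with equal integrals
    ([is_RInt_comp_primitive], [ex_RInt_comp_primitive_inv]).

    To prove it, cut I into cells on which the oscillations w of phi satisfy
    sum w |cell| <= eps ([RInt_cells]). On a cell where phi changes sign one has
    |phi| <= w ([no_sign_change_or_small]), so this cell contributes at most
    sup|h| w |cell| to the integral of h(Phi) phi, and its image under Phi has
    length at most w |cell|; all these cells together are negligible on both
    sides. On any other cell Phi is monotone, and partitions can be carried from
    one side to the other ([is_RInt_comp_monotone], [ex_RInt_comp_monotone_inv]).

    Integrability is handled through the predicate [approx], an enclosure of the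
    function up to an error of given integral: such enclosures can be glued
    along adjacent or overlapping intervals, so that no partition of Phi(I) has
    to be sorted out of the possibly overlapping images of the cells. *)

(** * Enclosures of a function by integrable functions *)

(** [h] is within [w] of the integrable function [l], the integral of [w] is at
    most [e], and the integral of [l] is within [e] of the candidate value [I].
    The error [e] adds up when intervals are glued. *)
Definition approx (h : R -> R) (p q I e : R) : Prop :=
  exists l w : R -> R, exists Il Iw : R,
    is_RInt l p q Il /\ is_RInt w p q Iw /\
    (forall x, p <= x <= q -> Rabs (h x - l x) <= w x) /\
    Iw <= e /\ Rabs (Il - I) <= e.

Lemma is_RInt_restrict (f : R -> R) (p q p' q' I : R) :
  p <= p' -> p' <= q' -> q' <= q -> is_RInt f p q I ->
  exists I', is_RInt f p' q' I'.
Proof.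
move=> H1 H2 H3 Hf.
have E : ex_RInt f p q by exists I.
have E1 : ex_RInt f p' q by apply: (ex_RInt_Chasles_2 _ p); [lra | ].
exact: (ex_RInt_Chasles_1 _ _ _ q).
Qed.

Definition glue (m : R) (f g : R -> R) (x : R) : R :=
  match Rle_dec x m with left _ => f x | right _ => g x end.

Lemma is_RInt_glue (f g : R -> R) (p m q If Ig : R) :
  p <= m -> m <= q -> is_RInt f p m If -> is_RInt g m q Ig ->
  is_RInt (glue m f g) p q (If + Ig).
Proof.
move=> H1 H2 Hf Hg.
apply: (is_RInt_Chasles _ p m q).
- apply: (is_RInt_ext f) Hf => x.
  rewrite Rmin_left // Rmax_right // => Hx.
  rewrite /glue; case: Rle_dec => //; lra.
- apply: (is_RInt_ext g) Hg => x.
  rewrite Rmin_left // Rmax_right // => Hx.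
  rewrite /glue; case: Rle_dec => //; lra.
Qed.

Lemma approx_glue (h : R -> R) (p m q I1 I2 e1 e2 : R) :
  p <= m -> m <= q -> approx h p m I1 e1 -> approx h m q I2 e2 ->
  approx h p q (I1 + I2) (e1 + e2).
Proof.
move=> H1 H2 [l1 [w1 [a1 [b1 [A1 [A2 [A3 [A4 A5]]]]]]]]
  [l2 [w2 [a2 [b2 [B1 [B2 [B3 [B4 B5]]]]]]]].
exists (glue m l1 l2), (glue m w1 w2), (a1 + a2), (b1 + b2).
split; [exact: is_RInt_glue | split; [exact: is_RInt_glue | split; [ | split]]].
- move=> x Hx; rewrite /glue; case: Rle_dec => Hm; [apply: A3 | apply: B3]; lra.
- lra.
- have -> : a1 + a2 - (I1 + I2) = (a1 - I1) + (a2 - I2) by ring.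
  apply: Rle_trans (Rabs_triang _ _) _; lra.
Qed.

Lemma approx_weaken (h : R -> R) (p q I e e' : R) :
  e <= e' -> approx h p q I e -> approx h p q I e'.
Proof.
move=> He [l [w [a [b [A1 [A2 [A3 [A4 A5]]]]]]]].
exists l, w, a, b; do 3 (split => //); split; lra.
Qed.

(** The bound [w] is nonnegative, so its integral can only drop on a smaller
    interval; the candidate value is then the integral of [l] itself. *)
Lemma approx_restrict (h : R -> R) (p q p' q' I e : R) :
  p <= p' -> p' <= q' -> q' <= q -> approx h p q I e ->
  exists I', approx h p' q' I' e.
Proof.
move=> H1 H2 H3 [l [w [a [b [A1 [A2 [A3 [A4 A5]]]]]]]].
have [Il Hl] := is_RInt_restrict l p q p' q' a H1 H2 H3 A1.
have [Iw Hw] := is_RInt_restrict w p q p' q' b H1 H2 H3 A2.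
exists Il, l, w, Il, Iw; do 2 (split => //); split; [ | split].
- move=> x Hx; apply: A3; lra.
- have w0 : forall x, p <= x <= q -> 0 <= w x.
    by move=> x Hx; apply: Rle_trans (Rabs_pos _) (A3 x Hx).
  have [I1 G1] := is_RInt_restrict w p q p p' b ltac:(lra) H1 ltac:(lra) A2.
  have [I2 G2] := is_RInt_restrict w p q q' q b ltac:(lra) H3 ltac:(lra) A2.
  have T := is_RInt_Chasles _ _ _ _ _ _ (is_RInt_Chasles _ _ _ _ _ _ G1 Hw) G2.
  have := is_RInt_unique _ _ _ _ T.
  rewrite (is_RInt_unique _ _ _ _ A2) /plus /= => E.
  have P1 : 0 <= I1.
    by apply: (is_RInt_ge_0 w p p') => // x Hx; apply: w0; lra.
  have P2 : 0 <= I2.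
    by apply: (is_RInt_ge_0 w q' q) => // x Hx; apply: w0; lra.
  lra.
- rewrite Rminus_diag Rabs_R0.
  have P : 0 <= b.
    apply: (is_RInt_ge_0 w p q) => //; first lra.
    by move=> x Hx; apply: Rle_trans (Rabs_pos _) (A3 x _); lra.
  lra.
Qed.

Lemma approx_ge0 (h : R -> R) (p q I e : R) : approx h p q I e -> 0 <= e.
Proof.
by move=> [l [w [a [b [_ [_ [_ [_ H]]]]]]]]; apply: Rle_trans (Rabs_pos _) H.
Qed.

Lemma is_RInt_cst (p q v : R) : is_RInt (fun _ => v) p q (v * (q - p)).
Proof. by rewrite Rmult_comm; apply: (is_RInt_const p q v). Qed.

Lemma approx_exact (h : R -> R) (p q I : R) :
  is_RInt h p q I -> approx h p q I 0.
Proof.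
move=> H; exists h, (fun _ => 0), I, 0; split => //; split; [ | split; [ | split]].
- by have := is_RInt_cst p q 0; rewrite Rmult_0_l.
- by move=> x _; rewrite Rminus_diag Rabs_R0; lra.
- lra.
- by rewrite Rminus_diag Rabs_R0; lra.
Qed.

Lemma approx_const (h : R -> R) (p q v w : R) :
  (forall x, p <= x <= q -> Rabs (h x - v) <= w) -> p <= q ->
  approx h p q (v * (q - p)) (w * (q - p)).
Proof.
move=> H Hpq.
exists (fun _ => v), (fun _ => w), (v * (q - p)), (w * (q - p)).
do 2 (split; first exact: is_RInt_cst); split => //; split; first lra.
rewrite Rminus_diag Rabs_R0; apply: Rmult_le_pos; last lra.
by apply: Rle_trans (Rabs_pos _) (H p _); lra.
Qed.

(** Two overlapping intervals: unless one contains the other, keep the first one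
    and only the part of the second one that sticks out. *)
Lemma approx_union (h : R -> R) (p q p' q' e e' : R) :
  p <= q -> p' <= q' -> p' <= q -> p <= q' ->
  (exists I, approx h p q I e) -> (exists I, approx h p' q' I e') ->
  exists I, approx h (Rmin p p') (Rmax q q') I (e + e').
Proof.
wlog: p q p' q' e e' / p <= p' => [W | L].
  move=> A B C D E F; case: (Rle_dec p p') => L; first exact: W.
  rewrite Rmin_comm Rmax_comm Rplus_comm; apply: W => //; lra.
move=> H1 H2 H3 H4 [I A] [I' A'].
have e0 := approx_ge0 _ _ _ _ _ A; have e0' := approx_ge0 _ _ _ _ _ A'.
rewrite Rmin_left //; case: (Rle_dec q' q) => Hq.
  rewrite Rmax_left //; exists I; apply: approx_weaken A; lra.
rewrite Rmax_right; last lra.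
have [J B] := approx_restrict h p' q' q q' I' e' H3 ltac:(lra) ltac:(lra) A'.
exists (I + J); apply: (approx_glue _ _ q) => //; lra.
Qed.

Lemma pointed_nil (x : R) : pointed_subdiv (SF_nil x).
Proof. by move=> i /PeanoNat.Nat.nlt_0_r. Qed.

(** [is_RInt] normalizes by the sign of [q - p], which vanishes when [p = q]; this
    lemma and the next one remove that factor once and for all. *)
Lemma is_RInt_sums (f : R -> R) (p q I : R) :
  p <= q -> is_RInt f p q I -> forall eps, 0 < eps -> exists d : posreal,
  forall ptd, seq_step (SF_lx ptd) < d -> pointed_subdiv ptd ->
    SF_h ptd = p -> last (SF_h ptd) (SF_lx ptd) = q ->
    Rabs (Riemann_sum f ptd - I) <= eps.
Proof.
move=> Hpq H eps He.
case: (Req_dec p q) => Epq.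
  have I0 : I = 0.
    have := is_RInt_unique _ _ _ _ H; rewrite Epq RInt_point => <- //.
  exists (mkposreal 1 Rlt_0_1) => ptd _ P h1 h2.
  rewrite Riemann_sum_zero; last 2 first.
  - exact: ptd_sort.
  - by rewrite h2 h1.
  by rewrite /zero /= I0 Rminus_diag Rabs_R0; lra.
have [d Hd] := H _ (locally_ball I (mkposreal eps He)).
exists d => ptd S P h1 h2.
have := Hd ptd S; rewrite Rmin_left // Rmax_right // => /(_ (conj P (conj h1 h2))).
rewrite sign_eq_1; last lra.
rewrite scal_one /ball /= /AbsRing_ball /= /abs /minus /plus /opp /= => ?.
apply: Rlt_le => //.
Qed.

Lemma sums_is_RInt (f : R -> R) (p q I : R) :
  p <= q ->
  (forall eps, 0 < eps -> exists d : posreal,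
  forall ptd, seq_step (SF_lx ptd) < d -> pointed_subdiv ptd ->
    SF_h ptd = p -> last (SF_h ptd) (SF_lx ptd) = q ->
    Rabs (Riemann_sum f ptd - I) <= eps) -> is_RInt f p q I.
Proof.
move=> Hpq H.
case: (Req_dec p q) => Epq.
  have -> : I = 0.
    apply: cond_eq => eps He.
    have [d Hd] := H (eps / 2) ltac:(lra).
    have := Hd (SF_nil p).
    rewrite /= /seq_step /= => /(_ (cond_pos d)).
    rewrite /Riemann_sum /zero /=.
    move=> /(_ (pointed_nil p) eq_refl Epq).
    rewrite (Rabs_minus_sym I); lra.
  rewrite -Epq; exact: is_RInt_point.
apply/filterlim_locally => eps.
have [d Hd] := H (eps / 2) ltac:(have := cond_pos eps; lra).
exists d => ptd S [P]; rewrite Rmin_left // Rmax_right // => [[h1 h2]].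
rewrite sign_eq_1; last lra.
rewrite scal_one /ball /= /AbsRing_ball /= /abs /minus /plus /opp /=.
apply: Rle_lt_trans (Hd _ S P h1 h2) _; have := cond_pos eps; lra.
Qed.

(** With the same tags, a Riemann sum of [h] differs from that of [l] by at most
    that of [w]; on fine partitions the last two are close to their integrals. *)
Lemma approx_is_RInt (h : R -> R) (p q I : R) :
  p <= q -> (forall eps, 0 < eps -> approx h p q I eps) -> is_RInt h p q I.
Proof.
move=> Hpq H; apply: sums_is_RInt => // eps He.
have [l [w [a [b [A1 [A2 [A3 [A4 A5]]]]]]]] := H (eps / 4) ltac:(lra).
have [d1 D1] := is_RInt_sums l p q a Hpq A1 (eps / 4) ltac:(lra).
have [d2 D2] := is_RInt_sums w p q b Hpq A2 (eps / 4) ltac:(lra).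
have Hd : 0 < Rmin d1 d2 by apply: Rmin_pos; apply: cond_pos.
exists (mkposreal _ Hd) => ptd /= S P h1 h2.
have B1 := D1 ptd (Rlt_le_trans _ _ _ S (Rmin_l _ _)) P h1 h2.
have B2 := D2 ptd (Rlt_le_trans _ _ _ S (Rmin_r _ _)) P h1 h2.
have B3 : Rabs (Riemann_sum (fun x => minus (h x) (l x)) ptd) <= Riemann_sum w ptd.
  apply: (Riemann_sum_norm (V := R_NormedModule)) => // t.
  rewrite /= h2 h1; exact: A3.
rewrite Riemann_sum_minus /minus /plus /opp /= in B3.
move: B1 B2 B3 A5; rewrite /Rabs.
repeat case: Rcase_abs; lra.
Qed.

Lemma approx_close (h : R -> R) (p q I e I' e' : R) :
  p <= q -> approx h p q I e -> approx h p q I' e' ->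
  Rabs (I - I') <= 2 * (e + e').
Proof.
move=> Hpq [l [w [a [b [A1 [A2 [A3 [A4 A5]]]]]]]]
  [l' [w' [a' [b' [B1 [B2 [B3 [B4 B5]]]]]]]].
have C : Rabs (a - a') <= b + b'.
  apply: (norm_RInt_le (fun x => minus (l x) (l' x)) (fun x => plus (w x) (w' x)) p q _ _ Hpq).
  - move=> x Hx; have := A3 x Hx; have := B3 x Hx.
    rewrite /norm /minus /plus /opp /= /abs /= /Rabs.
    repeat case: Rcase_abs; lra.
  - exact: (is_RInt_minus l l').
  - exact: (is_RInt_plus w w').
move: C A5 B5; rewrite /Rabs; repeat case: Rcase_abs; lra.
Qed.

(** The candidate values may vary with the error. By [approx_close] all the lower
    bounds [J - 2 e] lie below all the upper bounds [J' + 2 e'], and the least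
    upper bound of the former is the integral. *)
Lemma approx_ex_RInt (h : R -> R) (p q : R) :
  p <= q -> (forall eps, 0 < eps -> exists I, approx h p q I eps) ->
  ex_RInt h p q.
Proof.
move=> Hpq H.
pose S v := exists J e, approx h p q J e /\ v = J - 2 * e.
have B : forall J e, approx h p q J e -> is_upper_bound S (J + 2 * e).
  move=> J e A _ [J' [e' [A' ->]]].
  have := approx_close _ _ _ _ _ _ _ Hpq A A'.
  rewrite /Rabs; case: Rcase_abs; lra.
have [J0 A0] := H 1 Rlt_0_1.
have [I [I1 I2]] := completeness S (ex_intro _ _ (B _ _ A0))
  (ex_intro _ _ (ex_intro _ J0 (ex_intro _ 1 (conj A0 eq_refl)))).
exists I; apply: approx_is_RInt => // eps He.
have [J A] := H (eps / 3) ltac:(lra).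
have L := I1 _ (ex_intro _ J (ex_intro _ _ (conj A eq_refl))).
have U := I2 _ (B _ _ A).
have [l [w [a [b [A1 [A2 [A3 [A4 A5]]]]]]]] := A.
exists l, w, a, b; do 3 (split => //); split; first lra.
move: A5; rewrite /Rabs; repeat case: Rcase_abs; lra.
Qed.

(** * Oscillation sums *)

(** The property of being an indefinite integral, in a form that needs no base
    point and passes to subintervals. *)
Definition primitive_on (c d : R) (g G : R -> R) : Prop :=
  forall s t, c <= s -> s <= t -> t <= d -> is_RInt g s t (G t - G s).

Definition osc_le (g : R -> R) (x y w : R) : Prop :=
  forall s t, x <= s <= y -> x <= t <= y -> g s - g t <= w.

(** [e] bounds the sum over the cells of the list of the oscillation of [g] times
    the increment of [Theta]. Keeping the oscillations inside the derivation makes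
    inductions over the cells possible without carrying a list of bounds. *)
Inductive osc_sum (g Theta : R -> R) : list R -> R -> Prop :=
| osc_sum_point x e : 0 <= e -> osc_sum g Theta [:: x] e
| osc_sum_cell x y t w e :
    x <= y -> osc_le g x y w -> osc_sum g Theta (y :: t) e ->
    osc_sum g Theta (x :: y :: t) (w * (Theta y - Theta x) + e).

Lemma osc_sum_weaken (g Theta : R -> R) (L : list R) (e e' : R) :
  e <= e' -> osc_sum g Theta L e -> osc_sum g Theta L e'.
Proof.
move=> He H; elim: H e' He => [x {}e H | x y t w {}e Hxy Hw _ IH] e' He.
  apply: osc_sum_point; lra.
have -> : e' = w * (Theta y - Theta x) + (e' - w * (Theta y - Theta x)) by ring.
apply: osc_sum_cell => //; apply: IH; lra.
Qed.

Lemma osc_sum_cons_inv (g Theta : R -> R) (x y : R) (t : list R) (e : R) :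
  osc_sum g Theta (x :: y :: t) e -> exists w e',
  x <= y /\ osc_le g x y w /\ osc_sum g Theta (y :: t) e' /\
  e = w * (Theta y - Theta x) + e'.
Proof. by move=> H; inversion H; subst; exists w, e0. Qed.

Lemma osc_le_sup (g : R -> R) (x y K : R) :
  x <= y -> (forall s, x <= s <= y -> Rabs (g s) <= K) ->
  exists w, osc_le g x y w /\ forall eps, 0 < eps ->
    exists s t, x <= s <= y /\ x <= t <= y /\ w - eps <= g s - g t.
Proof.
move=> Hxy HK.
pose S v := exists s t, x <= s <= y /\ x <= t <= y /\ v = g s - g t.
have B : bound S.
  exists (2 * K) => _ [s [t [Hs [Ht ->]]]].
  move: (HK s Hs) (HK t Ht); rewrite /Rabs; repeat case: Rcase_abs; lra.
have NE : exists v, S v by exists (g x - g x), x, x; split; [lra | split; [lra | ]].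
have [w [W1 W2]] := completeness S B NE.
exists w; split; first by move=> s t Hs Ht; apply: W1; exists s, t.
move=> eps He; apply: NNPP => N.
have : is_upper_bound S (w - eps).
  move=> _ [s [t [Hs [Ht ->]]]].
  case: (Rle_dec (g s - g t) (w - eps)) => // C; case: N.
  exists s, t; split => //; split => //; lra.
move/W2; lra.
Qed.

Lemma sorted_le_last (x : R) (t : list R) : sorted Rle (x :: t) -> x <= last x t.
Proof.
elim: t x => [|y t IH] x /=; first lra.
by move=> [H1 /IH /= H2]; lra.
Qed.

Lemma RS_sum_cons (g Theta : R -> R) (x xi : R) (s : @SF_seq R) :
  RS_sum g Theta (SF_cons (x, xi) s) =
  g xi * (Theta (SF_h s) - Theta x) + RS_sum g Theta s.
Proof. by rewrite /RS_sum /=; case: (SF_t s). Qed.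

Lemma RS_sum_Riemann (g : R -> R) (s : @SF_seq R) :
  RS_sum g (fun x => x) s = Riemann_sum g s.
Proof.
elim/(@SF_cons_ind R): s => [x | [x xi] s IH] //.
by rewrite RS_sum_cons Riemann_sum_cons IH /scal /plus /= /mult /= Rmult_comm.
Qed.

Lemma pointed_cons (x xi : R) (s : @SF_seq R) :
  x <= xi <= SF_h s -> pointed_subdiv s -> pointed_subdiv (SF_cons (x, xi) s).
Proof.
move=> H P [|i]; first by move=> _; case: s H {P}.
rewrite SF_size_cons SF_lx_cons SF_ly_cons => Hi.
exact: (P i (proj2 (PeanoNat.Nat.succ_lt_mono _ _) Hi)).
Qed.

Lemma pointed_head (x xi : R) (s : @SF_seq R) :
  pointed_subdiv (SF_cons (x, xi) s) -> x <= xi <= SF_h s.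
Proof.
by move=> /(_ 0%nat); rewrite SF_size_cons => /(_ (PeanoNat.Nat.lt_0_succ _)).
Qed.

(** If two choices of tags on a fixed list of division points never change the
    sum by more than [e], then the oscillation sum is at most [e]: tag each cell
    by points where the oscillation is nearly attained. The slack [eps] pays for
    the suprema that are not attained. *)
Lemma osc_sum_of_sums (g Theta : R -> R) (K x : R) (t : list R) (e : R) :
  sorted Rle (x :: t) ->
  (forall s, x <= s <= last x t -> Rabs (g s) <= K) ->
  (forall s u, x <= s -> s <= u -> u <= last x t -> Theta s <= Theta u) ->
  (forall p q, SF_lx p = x :: t -> SF_lx q = x :: t ->
     pointed_subdiv p -> pointed_subdiv q ->
     RS_sum g Theta p - RS_sum g Theta q <= e) ->
  forall eps, 0 < eps -> osc_sum g Theta (x :: t) (e + eps).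
Proof.
elim: t x e => [|y t IH] x e.
  move=> _ _ _ H eps He; apply: osc_sum_point.
  have := H (SF_nil x) (SF_nil x) eq_refl eq_refl (pointed_nil x) (pointed_nil x).
  rewrite /RS_sum /=; lra.
move=> [Hxy St] HK HT H eps He.
have Hl := sorted_le_last _ _ St.
have [w [W1 W2]] := osc_le_sup g x y K Hxy ltac:(move=> s Hs; apply: HK; simpl; lra).
have D : 0 <= Theta y - Theta x.
  have := HT x y ltac:(lra) Hxy Hl; lra.
set D' := Theta y - Theta x in D *.
(* The first cell may use half of the slack; [+ 1] covers a zero increment. *)
pose eta := eps / 2 / (D' + 1).
have Eeta : eta * D' <= eps / 2.
  have -> : eta * D' = eps / 2 * (D' / (D' + 1)) by rewrite /eta; field; lra.
  rewrite -[X in _ <= X]Rmult_1_r; apply: Rmult_le_compat_l; first lra.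
  apply/Rle_div_l; lra.
have eta0 : 0 < eta by apply: Rdiv_lt_0_compat; lra.
have [s [u [Hs [Hu Hsu]]]] := W2 eta eta0.
have -> : e + eps = w * D' + (e + eps - w * D') by ring.
apply: osc_sum_cell => //.
apply: (osc_sum_weaken _ _ _ (e - (w - eta) * D' + eps / 2)).
  have : (w - eta) * D' = w * D' - eta * D' by ring.
  lra.
apply: IH => //.
- move=> z Hz; apply: HK; simpl; lra.
- move=> z v Hz Hzv Hv; apply: HT; simpl; lra.
- move=> p q Hp Hq Pp Pq.
  have hp : SF_h p = y by case: Hp.
  have hq : SF_h q = y by case: Hq.
  have := H (SF_cons (x, s) p) (SF_cons (x, u) q).
  rewrite !SF_lx_cons Hp Hq /= => /(_ eq_refl eq_refl).
  move=> /(_ (pointed_cons x s p ltac:(lra) Pp) (pointed_cons x u q ltac:(lra) Pq)).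
  rewrite !RS_sum_cons hp hq -/D' => L.
  have : (w - eta) * D' <= (g s - g u) * D' by apply: Rmult_le_compat_r.
  lra.
- lra.
Qed.

(** The way oscillation sums are used: [Q x y e] says that [e] is an admissible
    error on [x, y], and errors add up from cell to cell. *)
Lemma osc_sum_cells (g Theta : R -> R) (c d : R) (Q : R -> R -> R -> Prop) :
  (forall x y e e', c <= x -> x <= y -> y <= d -> e <= e' -> Q x y e -> Q x y e') ->
  (forall x y w, c <= x -> x <= y -> y <= d -> osc_le g x y w ->
     Q x y (w * (Theta y - Theta x))) ->
  (forall x y z e e', c <= x -> x <= y -> y <= z -> z <= d ->
     Q x y e -> Q y z e' -> Q x z (e + e')) ->
  forall x t e, osc_sum g Theta (x :: t) e -> c <= x -> last x t <= d ->
  sorted Rle (x :: t) -> Q x (last x t) e.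
Proof.
move=> Qw Qc Qg x t; elim: t x => [|y t IH] x e H Hx Hd St.
  have He : 0 <= e by inversion H.
  apply: (Qw _ _ (0 * (Theta x - Theta x))) => //=; try lra.
  apply: Qc => //; try lra.
  move=> s u Hs Hu; have -> : s = u by lra.
  lra.
have [w [e' [Hxy [Hw [He ->]]]]] := osc_sum_cons_inv _ _ _ _ _ _ H.
case: St => _ St.
have Hl := sorted_le_last _ _ St; rewrite /= in Hd *.
apply: (Qg _ y) => //.
- apply: Qc => //; lra.
- apply: IH => //; lra.
Qed.

(** * Fine refinements of partitions *)

(** A mesh condition on a list that passes to every larger list: each point is
    followed by a division point at distance at most [del]. *)
Lemma dense_step (del : R) (x : R) (t : list R) :
  0 <= del -> sorted Rle (x :: t) ->
  (forall z, x <= z < last x t -> exists p, In p (x :: t) /\ z < p <= z + del) ->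
  seq_step (x :: t) <= del.
Proof.
move=> Hd; elim: t x => [|y t IH] x; first by [].
move=> [Hxy St] H; rewrite /seq_step /=.
have Hl := sorted_le_last _ _ St.
apply: Rmax_lub; last first.
  apply: IH => // z Hz; have [p [Ip Hp]] := H z ltac:(simpl; lra).
  exists p; split => //; case: Ip => // E; lra.
rewrite Rabs_pos_eq; last lra.
case: (Req_dec x y) => Exy; first lra.
have [p [Ip Hp]] := H x ltac:(simpl; lra).
(* [p] is a division point after [x], hence not before its successor [y]. *)
have : y <= p.
  case: Ip => [E|Ip]; first lra.
  elim: t y {IH H Hxy Hl Exy} St Ip => [|u t IH] y /= St [E|] //; try lra.
  by move=> Ip; case: St => Hy St; have := IH u St Ip; lra.
lra.
Qed.

Lemma dense_exists (del : R) (n : nat) (c d : R) :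
  0 < del -> c <= d <= c + INR n * del ->
  exists t, last c t = d /\ sorted Rle (c :: t) /\
    forall z, c <= z < d -> exists p, In p (c :: t) /\ z < p <= z + del.
Proof.
move=> Hd; elim: n c => [|n IH] c.
  rewrite /= => H; exists [::]; split; [simpl; lra | split => //= z Hz; lra].
rewrite S_INR => H; case: (Rle_dec d (c + del)) => C.
  exists [:: d]; split => //; split; first by split; [lra | ].
  move=> z Hz; exists d; split; [by right; left | lra].
have [t [T1 [T2 T3]]] := IH (c + del) ltac:(lra).
exists (c + del :: t); split => //; split; first by split; [lra | ].
move=> z Hz; case: (Rle_dec (c + del) z) => Cz.
  have [p [Ip Hp]] := T3 z ltac:(lra).
  by exists p; split => //; right.
exists (c + del); split; [by right; left | lra].
Qed.

Lemma insert_point (z c d : R) (t : list R) :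
  last c t = d -> sorted Rle (c :: t) -> c <= z <= d ->
  exists t', last c t' = d /\ sorted Rle (c :: t') /\ incl (z :: c :: t) (c :: t').
Proof.
elim: t c => [|y t IH] c.
  move=> /= <- _ Hz; exists [::]; split => //; split => //.
  have -> : z = c by lra.
  move=> u [|] //; by left.
move=> Hl [Hcy St] Hz; case: (Rle_dec z y) => C.
  exists (z :: y :: t); split => //; split.
    by split; [lra | split].
  move=> u /=; tauto.
have [t' [T1 [T2 T3]]] := IH y Hl St ltac:(lra).
exists (y :: t'); split => //; split => //.
move=> u [E | [E | E]]; [right; apply: T3; by left | by left | right; apply: T3; by right].
Qed.

Lemma partition_between (c d : R) (P : list R) :
  is_partition c d P -> c <= d /\ forall p, In p P -> c <= p <= d.
Proof.
move=> [t [-> [<- St]]] {P d}; split; first exact: sorted_le_last.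
elim: t c St => [|y t IH] c St p [<-|] //.
- by move=> /=; lra.
- by have := sorted_le_last _ _ St; lra.
- by case: St => Hc St Ip; have /= := IH y St p Ip; lra.
Qed.

Lemma merge_partition (c d : R) (P Q : list R) :
  is_partition c d Q -> (forall p, In p P -> c <= p <= d) ->
  exists P', is_partition c d P' /\ incl P P' /\ incl Q P'.
Proof.
move=> HQ; elim: P => [|p P IH] HP.
  by exists Q; split => //; split.
have [P' [[t [E [T1 T2]]] [I1 I2]]] := IH ltac:(by move=> q Iq; apply: HP; right).
rewrite E in T2; have [t' [U1 [U2 U3]]] := insert_point p c d t T1 T2 (HP p (or_introl eq_refl)).
exists (c :: t'); split; first by exists t'.
rewrite -E in U3; split.
  move=> q [<-|Iq]; first by apply: U3; left.
  by apply: U3; right; apply: I1.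
by move=> q Iq; apply: U3; right; apply: I2.
Qed.

(** Links the two notions of limit: all refinements of [P'] have mesh less than
    [del], so a limit along the mesh is a limit along refinement. *)
Lemma fine_refinement (c d del : R) (P : list R) :
  0 < del -> is_partition c d P -> exists P', is_partition c d P' /\ incl P P' /\
  forall L, is_partition c d L -> incl P' L -> seq_step L < del.
Proof.
move=> Hdel HP; have [Hcd HPb] := partition_between _ _ _ HP.
have [n Hn] := INR_unbounded ((d - c) / (del / 2)).
have Hn' : d - c <= INR n * (del / 2) by apply/Rle_div_l; lra.
have [t [T1 [T2 T3]]] := dense_exists (del / 2) n c d ltac:(lra) ltac:(lra).
have HQ : is_partition c d (c :: t) by exists t.
have [P' [H1 [H2 H3]]] := merge_partition c d P _ HQ HPb.
exists P'; split => //; split => // L [u [EL [U1 U2]]] IL.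
apply: (Rle_lt_trans _ (del / 2)); last lra.
rewrite EL in U2 IL *; apply: dense_step => //; first lra.
rewrite U1 => z /T3 [p [Ip Hp]]; exists p; split => //.
by apply: IL; apply: H3.
Qed.

Lemma trivial_partition (c d : R) : c <= d -> is_partition c d [:: c; d].
Proof. by move=> H; exists [:: d]. Qed.

Lemma partition_tags (c d : R) (ptd : @SF_seq R) :
  is_partition c d (SF_lx ptd) -> SF_h ptd = c /\ last (SF_h ptd) (SF_lx ptd) = d.
Proof. by case=> t [E [<- _]]; rewrite E; case: E => ->. Qed.

(** * Integrals against an indefinite integral *)

Lemma fine_osc_sum (g : R -> R) (c d I : R) :
  c <= d -> bounded_on c d g -> is_RInt g c d I -> forall eps, 0 < eps ->
  exists del, 0 < del /\ forall L, is_partition c d L -> seq_step L < del ->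
    osc_sum g (fun x => x) L eps.
Proof.
move=> Hcd [K HK] HI eps He.
have [del Hdel] := is_RInt_sums g c d I Hcd HI (eps / 3) ltac:(lra).
exists del; split; first exact: cond_pos.
move=> L [t [-> [T1 T2]]] HL.
have -> : eps = 2 * (eps / 3) + eps / 3 by field.
apply: (osc_sum_of_sums _ _ K) => //; try lra.
- rewrite T1 => s Hs; exact: HK.
- have HS p : SF_lx p = c :: t -> pointed_subdiv p ->
    Rabs (RS_sum g (fun x => x) p - I) <= eps / 3.
    move=> Ep Pp; rewrite RS_sum_Riemann.
    case: (partition_tags c d p); first by exists t; rewrite Ep.
    by move=> h1 h2; apply: Hdel => //; rewrite Ep.
  move=> p q Ep Eq Pp Pq; move: (HS p Ep Pp) (HS q Eq Pq).
  rewrite /Rabs; repeat case: Rcase_abs; lra.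
Qed.

(** On a cell [x, y] with tag xi, the increment of [Psi] is the integral of [psi],
    so it differs from psi(xi) (y - x) by at most the oscillation of [psi] times
    the length. *)
Lemma RS_sum_density (f psi Psi : R -> R) (c d K e : R) (ptd : @SF_seq R) :
  (forall x, c <= x <= d -> Rabs (f x) <= K) -> primitive_on c d psi Psi ->
  osc_sum psi (fun x => x) (SF_lx ptd) e -> pointed_subdiv ptd ->
  c <= SF_h ptd -> last (SF_h ptd) (SF_lx ptd) <= d ->
  Rabs (RS_sum f Psi ptd - RS_sum (fun x => f x * psi x) (fun x => x) ptd) <= K * e.
Proof.
move=> HK HP.
elim/(@SF_cons_ind R): ptd e => [x | [x xi] s IH] e HO Hp Hc Hd.
  inversion HO; subst; rewrite /RS_sum /= Rminus_diag Rabs_R0.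
  apply: Rmult_le_pos => //.
  by apply: Rle_trans (Rabs_pos _) (HK x _); simpl in *; lra.
have Hxi := pointed_head _ _ _ Hp; have Hs := ptd_cons _ _ Hp.
have Hl := sorted_le_last _ _ (ptd_sort _ Hs).
rewrite /= in Hc Hd Hl.
have [w [e' [H1 [H2 [H4 ->]]]]] := osc_sum_cons_inv _ _ _ _ _ _ HO.
rewrite !RS_sum_cons; set y := SF_h s in IH Hxi H1 H2 H4 Hd Hl *.
have {}IH := IH _ H4 Hs ltac:(lra) Hd.
have C : Rabs (Psi y - Psi x - psi xi * (y - x)) <= (y - x) * w.
  apply: (norm_RInt_le_const (V := R_NormedModule) (fun z => minus (psi z) (psi xi)) x y) => //.
    move=> z Hz; have := H2 z xi Hz Hxi; have := H2 xi z Hxi Hz.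
    rewrite /norm /minus /plus /opp /= /abs /= /Rabs; case: Rcase_abs; lra.
  have := is_RInt_minus _ _ _ _ _ _ (HP x y Hc H1 ltac:(lra)) (is_RInt_const x y (psi xi)).
  by rewrite /scal /= /mult /= (Rmult_comm (psi xi)).
set A := RS_sum f _ _ in IH *; set B := RS_sum _ _ s in IH *.
have -> : f xi * (Psi y - Psi x) + A - (f xi * psi xi * (y - x) + B) =
  f xi * (Psi y - Psi x - psi xi * (y - x)) + (A - B) by ring.
apply: Rle_trans (Rabs_triang _ _) _.
rewrite Rabs_mult Rmult_plus_distr_l; apply: Rplus_le_compat => //.
apply: Rmult_le_compat; try exact: Rabs_pos.
- apply: HK; lra.
- by rewrite (Rmult_comm w).
Qed.

Lemma fine_RS_sum_density (f psi Psi : R -> R) (c d : R) :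
  c <= d -> bounded_on c d f -> bounded_on c d psi -> primitive_on c d psi Psi ->
  forall eps, 0 < eps -> exists del, 0 < del /\ forall ptd,
    is_partition c d (SF_lx ptd) -> pointed_subdiv ptd -> seq_step (SF_lx ptd) < del ->
    Rabs (RS_sum f Psi ptd - RS_sum (fun x => f x * psi x) (fun x => x) ptd) <= eps.
Proof.
move=> Hcd [K HK] Hb HP eps He.
have K0 : 0 <= K by apply: Rle_trans (Rabs_pos _) (HK c _); lra.
have [del [D1 D2]] := fine_osc_sum psi c d _ Hcd Hb
  (HP c d ltac:(lra) Hcd ltac:(lra)) (eps / (K + 1)) ltac:(apply: Rdiv_lt_0_compat; lra).
exists del; split => // ptd H1 H2 H3.
have [h1 h2] := partition_tags _ _ _ H1.
apply: Rle_trans (RS_sum_density f psi Psi c d K _ ptd HK HP (D2 _ H1 H3) H2 _ _) _.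
- lra.
- lra.
- have -> : K * (eps / (K + 1)) = eps * (K / (K + 1)) by field; lra.
  rewrite -[X in _ <= X]Rmult_1_r; apply: Rmult_le_compat_l; first lra.
  apply/Rle_div_l; lra.
Qed.

(** Fine Riemann sums of [f psi] are close to its integral and to the sums of [f]
    against [Psi]. *)
Lemma is_RInt_is_RSInt (f psi Psi : R -> R) (c d A : R) :
  c <= d -> bounded_on c d f -> bounded_on c d psi -> primitive_on c d psi Psi ->
  is_RInt (fun x => f x * psi x) c d A -> is_RSInt f Psi c d A.
Proof.
move=> Hcd Hf Hpsi HP HA eps He.
have [d1 D1] := is_RInt_sums _ c d A Hcd HA (eps / 2) ltac:(lra).
have [d2 [d20 D2]] := fine_RS_sum_density f psi Psi c d Hcd Hf Hpsi HP (eps / 2) ltac:(lra).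
have Hd : 0 < Rmin d1 d2 by apply: Rmin_pos => //; apply: cond_pos.
have [P [P1 [_ P2]]] := fine_refinement c d _ _ Hd (trivial_partition c d Hcd).
exists P; split => // ptd T1 T2 T3.
have S := P2 _ T1 T3; have [h1 h2] := partition_tags _ _ _ T1.
have B1 := D1 ptd (Rlt_le_trans _ _ _ S (Rmin_l _ _)) T2 h1 h2.
have B2 := D2 ptd T1 T2 (Rlt_le_trans _ _ _ S (Rmin_r _ _)).
rewrite RS_sum_Riemann in B2.
move: B1 B2; rewrite /Rabs; repeat case: Rcase_abs; lra.
Qed.

(** Passing from refinement to mesh: one partition on which the sums of [f]
    against [Psi] hardly depend on the tags, made fine enough for [psi], gives a
    small oscillation sum for [f psi], hence an enclosure of it. *)
Lemma ex_RSInt_ex_RInt (f psi Psi : R -> R) (c d : R) :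
  c <= d -> bounded_on c d f -> bounded_on c d psi -> primitive_on c d psi Psi ->
  ex_RSInt f Psi c d -> ex_RInt (fun x => f x * psi x) c d.
Proof.
move=> Hcd Hf Hpsi HP [A HA].
apply: approx_ex_RInt => // eps He.
have [P [P1 P2]] := HA (eps / 5) ltac:(lra).
have [d2 [d20 D2]] := fine_RS_sum_density f psi Psi c d Hcd Hf Hpsi HP (eps / 5) ltac:(lra).
have [L [L1 [L2 L3]]] := fine_refinement c d _ P d20 P1.
have SL := L3 L L1 (incl_refl _).
case: (L1) => t [EL [T1 T2]].
case: Hf => K HK; case: Hpsi => M HM.
have O : osc_sum (fun x => f x * psi x) (fun x => x) L (4 * (eps / 5) + eps / 5).
  rewrite EL in T2 *; apply: (osc_sum_of_sums _ _ (K * M)) => //; last lra.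
    rewrite T1 => s Hs; rewrite Rabs_mult.
    by apply: Rmult_le_compat; try exact: Rabs_pos; [apply: HK | apply: HM].
  have HS p : SF_lx p = c :: t -> pointed_subdiv p ->
    Rabs (RS_sum (fun x => f x * psi x) (fun x => x) p - A) <= 2 * (eps / 5).
    rewrite -EL => Ep Pp.
    have B1 := P2 p ltac:(by rewrite Ep) Pp ltac:(by rewrite Ep).
    have B2 := D2 p ltac:(by rewrite Ep) Pp ltac:(by rewrite Ep).
    move: B1 B2; rewrite /Rabs; repeat case: Rcase_abs; lra.
  move=> p q Ep Eq Pp Pq; move: (HS p Ep Pp) (HS q Eq Pq).
  rewrite /Rabs; repeat case: Rcase_abs; lra.
rewrite EL in O T2; rewrite -T1.
have := osc_sum_cells _ _ c d (fun x y e => exists I, approx (fun x => f x * psi x) x y I e) _ _ _ c t _ O _ _ T2.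
have -> : 4 * (eps / 5) + eps / 5 = eps by field.
apply; try lra.
- by move=> x y e e' _ _ _ E [I HI]; exists I; apply: approx_weaken HI.
- move=> x y w _ Hxy _ Hw; exists (f x * psi x * (y - x)).
  apply: approx_const => // z Hz.
  have := Hw x z ltac:(lra) Hz; have := Hw z x Hz ltac:(lra).
  rewrite /Rabs; case: Rcase_abs; lra.
- move=> x y z e e' _ Hxy Hyz _ [I HI] [I' HI']; exists (I + I').
  exact: (approx_glue _ _ y).
Qed.

(** * Cells and indefinite integrals *)

Lemma ex_RInt_sub (f : R -> R) (c d u v : R) :
  ex_RInt f c d -> c <= u <= d -> c <= v <= d -> ex_RInt f u v.
Proof.
move=> Hf Hu Hv; apply: (ex_RInt_inside f u v ((c + d) / 2) ((d - c) / 2)).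
- have -> : (c + d) / 2 - (d - c) / 2 = c by field.
  by have -> : (c + d) / 2 + (d - c) / 2 = d by field.
- apply: Rabs_le; lra.
- apply: Rabs_le; lra.
Qed.

(** Riemann's criterion of integrability, as an induction principle over the cells
    of a fine partition; [Q x y e] says that [e] is an admissible error on [x, y]. *)
Lemma RInt_cells (g : R -> R) (c d : R) (Q : R -> R -> R -> Prop) :
  c <= d -> bounded_on c d g -> ex_RInt g c d ->
  (forall x y e e', c <= x -> x <= y -> y <= d -> e <= e' -> Q x y e -> Q x y e') ->
  (forall x y w, c <= x -> x <= y -> y <= d -> osc_le g x y w ->
     Q x y (w * (y - x))) ->
  (forall x y z e e', c <= x -> x <= y -> y <= z -> z <= d ->
     Q x y e -> Q y z e' -> Q x z (e + e')) ->
  forall eps, 0 < eps -> Q c d eps.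
Proof.
move=> Hcd Hb [I HI] Qw Qc Qg eps He.
have [del [D1 D2]] := fine_osc_sum g c d I Hcd Hb HI eps He.
have [L [L1 [_ L3]]] := fine_refinement c d _ _ D1 (trivial_partition c d Hcd).
have O := D2 _ L1 (L3 _ L1 (incl_refl _)).
case: L1 => t [EL [T1 T2]]; rewrite EL in O T2; rewrite -T1.
apply: (osc_sum_cells _ _ c d Q Qw Qc Qg _ _ _ O) => //; lra.
Qed.

Lemma primitive_sub (c d s t : R) (g G : R -> R) :
  c <= s -> t <= d -> primitive_on c d g G -> primitive_on s t g G.
Proof. move=> H1 H2 H u v Hu Huv Hv; apply: H; lra. Qed.

Lemma bounded_sub (c d s t : R) (g : R -> R) :
  c <= s -> t <= d -> bounded_on c d g -> bounded_on s t g.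
Proof. move=> H1 H2 [K HK]; exists K => x Hx; apply: HK; lra. Qed.

Lemma indefinite_integral_primitive (c d s0 : R) (g G : R -> R) :
  c <= s0 <= d -> ex_RInt g c d -> indefinite_integral c d s0 g G ->
  primitive_on c d g G.
Proof.
move=> H0 Hg HG s t Hs Hst Ht.
rewrite (HG s) ?(HG t); try lra.
have E : RInt g s0 t = RInt g s0 s + RInt g s t.
  rewrite -[LHS](RInt_Chasles g s0 s t) //; apply: (ex_RInt_sub g c d) => //; lra.
have -> : G s0 + RInt g s0 t - (G s0 + RInt g s0 s) = RInt g s t by rewrite E; ring.
apply: (RInt_correct g); apply: (ex_RInt_sub g c d) => //; lra.
Qed.

Lemma primitive_lipschitz (c d M : R) (g G : R -> R) :
  primitive_on c d g G -> (forall x, c <= x <= d -> Rabs (g x) <= M) ->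
  forall s t, c <= s -> s <= t -> t <= d -> Rabs (G t - G s) <= M * (t - s).
Proof.
move=> HG HM s t Hs Hst Ht; rewrite Rmult_comm.
apply: (norm_RInt_le_const (V := R_NormedModule) g s t) => //; last exact: HG.
move=> x Hx; apply: HM; lra.
Qed.

(** Composing with the retraction onto [s, t] turns a function that is continuous
    on [s, t] into one that is continuous on the line, as the intermediate value
    theorem requires. *)
Definition clamp (s t x : R) : R := Rmax s (Rmin t x).

Lemma primitive_clamp_continuous (s t : R) (g G : R -> R) :
  s <= t -> bounded_on s t g -> primitive_on s t g G ->
  continuity (fun x => G (clamp s t x)).
Proof.
move=> Hst [M HM] HG x0.
have HL := primitive_lipschitz s t M g G HG HM.
have M0 : 0 <= M by apply: Rle_trans (Rabs_pos _) (HM s _); lra.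
have C : forall x y, x <= y -> s <= clamp s t x /\ clamp s t x <= clamp s t y /\
    clamp s t y <= t /\ clamp s t y - clamp s t x <= y - x.
  move=> x y Hxy; rewrite /clamp /Rmax /Rmin.
  repeat case: Rle_dec; lra.
have L : forall x y, Rabs (G (clamp s t y) - G (clamp s t x)) <= M * Rabs (y - x).
  have W : forall x y, x <= y ->
      Rabs (G (clamp s t y) - G (clamp s t x)) <= M * Rabs (y - x).
    move=> x y Hxy; have [C1 [C2 [C3 C4]]] := C x y Hxy.
    apply: Rle_trans (HL _ _ C1 C2 C3) _; rewrite Rabs_pos_eq; last lra.
    exact: Rmult_le_compat_l.
  move=> x y; case: (Rle_dec x y) => Hxy; first exact: W.
  rewrite Rabs_minus_sym (Rabs_minus_sym y); apply: W; lra.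
move=> eps He; exists (eps / (M + 1)); split; first by apply: Rdiv_lt_0_compat; lra.
move=> x [_]; rewrite /dist /= /Rdist => Hx.
apply: Rle_lt_trans (L _ _) _.
apply: (Rle_lt_trans _ ((M + 1) * Rabs (x - x0))).
  have := Rabs_pos (x - x0); nra.
have -> : eps = (M + 1) * (eps / (M + 1)) by field; lra.
apply: Rmult_lt_compat_l => //; lra.
Qed.

Lemma clamp_id (s t x : R) : s <= x <= t -> clamp s t x = x.
Proof. by move=> H; rewrite /clamp Rmin_right ?Rmax_right; lra. Qed.

Lemma primitive_IVT (s t v : R) (g G : R -> R) :
  s <= t -> bounded_on s t g -> primitive_on s t g G ->
  Rmin (G s) (G t) <= v <= Rmax (G s) (G t) -> exists m, s <= m <= t /\ G m = v.
Proof.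
move=> Hst Hb HG Hv.
have := IVT_gen _ s t v (primitive_clamp_continuous s t g G Hst Hb HG).
rewrite !clamp_id; try lra.
case=> // m; rewrite Rmin_left // Rmax_right // => [[Hm Em]].
by exists m; split => //; rewrite -Em clamp_id.
Qed.

Definition is_image (G : R -> R) (s t p q : R) : Prop :=
  forall z, p <= z <= q <-> exists u, s <= u <= t /\ G u = z.

Lemma primitive_image (s t : R) (g G : R -> R) :
  s <= t -> bounded_on s t g -> primitive_on s t g G ->
  exists p q, p <= q /\ is_image G s t p q.
Proof.
move=> Hst Hb HG.
have HC := primitive_clamp_continuous s t g G Hst Hb HG.
have [xM [M1 M2]] := continuity_ab_maj _ s t Hst (fun c _ => HC c).
have [xm [m1 m2]] := continuity_ab_min _ s t Hst (fun c _ => HC c).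
have {}M1 : forall c, s <= c <= t -> G c <= G xM.
  by move=> c Hc; have := M1 c Hc; rewrite !clamp_id.
have {}m1 : forall c, s <= c <= t -> G xm <= G c.
  by move=> c Hc; have := m1 c Hc; rewrite !clamp_id.
exists (G xm), (G xM); split; first exact: m1.
move=> z; split; last by move=> [u [Hu <-]]; split; [exact: m1 | exact: M1].
move=> Hz; case: (Rle_dec xm xM) => C.
- have [m [H1 H2]] := primitive_IVT xm xM z g G C (bounded_sub _ _ _ _ _ (proj1 m2) (proj2 M2) Hb)
    (primitive_sub _ _ _ _ _ _ (proj1 m2) (proj2 M2) HG)
    ltac:(rewrite Rmin_left ?Rmax_right; lra).
  exists m; split => //; lra.
- have [m [H1 H2]] := primitive_IVT xM xm z g G ltac:(lra) (bounded_sub _ _ _ _ _ (proj1 M2) (proj2 m2) Hb)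
    (primitive_sub _ _ _ _ _ _ (proj1 M2) (proj2 m2) HG)
    ltac:(rewrite Rmin_right ?Rmax_left; lra).
  exists m; split => //; lra.
Qed.

Lemma primitive_nondecreasing (c d : R) (g G : R -> R) :
  primitive_on c d g G -> (forall x, c <= x <= d -> 0 <= g x) ->
  forall s t, c <= s -> s <= t -> t <= d -> G s <= G t.
Proof.
move=> HG Hg s t Hs Hst Ht.
have : 0 <= G t - G s; last lra.
apply: (is_RInt_ge_0 g s t) => //; first exact: HG.
move=> x Hx; apply: Hg; lra.
Qed.

Lemma bounded_between (s t K : R) (h g G : R -> R) :
  s <= t -> bounded_on s t g -> primitive_on s t g G ->
  (forall x, s <= x <= t -> Rabs (h (G x)) <= K) ->
  forall v, Rmin (G s) (G t) <= v <= Rmax (G s) (G t) -> Rabs (h v) <= K.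
Proof.
move=> Hst Hb HG HK v Hv.
have [m [Hm <-]] := primitive_IVT s t v g G Hst Hb HG Hv.
exact: HK.
Qed.

(** * Substitution where the integrand keeps its sign *)

(** Cells [u, v] of the image pull back to intervals [s, t], on which h(Phi) phi is
    within w phi of h(u) phi, and the integral of w phi is w (v - u). The property
    is required for all preimages [s], [t] of [u], [v], so that two adjacent cells
    can be glued at a preimage of their common endpoint, given by the intermediate
    value theorem. *)
Lemma is_RInt_comp_nondecreasing (x y : R) (h phi Phi : R -> R) (J : R) :
  x <= y -> bounded_on x y phi -> primitive_on x y phi Phi ->
  bounded_on x y (fun t => h (Phi t)) ->
  (forall t, x <= t <= y -> 0 <= phi t) ->
  is_RInt h (Phi x) (Phi y) J -> is_RInt (fun t => h (Phi t) * phi t) x y J.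
Proof.
move=> Hxy Hphi HPhi [K HK] Hpos HJ.
have mono := primitive_nondecreasing x y phi Phi HPhi Hpos.
have Hle : Phi x <= Phi y by apply: mono; lra.
have Hbh : bounded_on (Phi x) (Phi y) h.
  exists K => v Hv; apply: (bounded_between x y K h phi Phi) => //.
  by rewrite Rmin_left // Rmax_right.
have Eh : ex_RInt h (Phi x) (Phi y) by exists J.
apply: approx_is_RInt => // eps He; rewrite -(is_RInt_unique _ _ _ _ HJ).
pose Q u v e := forall s t, x <= s -> s <= t -> t <= y -> Phi s = u -> Phi t = v ->
  approx (fun t => h (Phi t) * phi t) s t (RInt h u v) e.
apply: (RInt_cells h (Phi x) (Phi y) Q) => //; try lra.
- move=> u v e e' _ _ _ E H s t H1 H2 H3 H4 H5.
  by apply: approx_weaken E _; apply: H.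
- move=> u v w Hu Huv Hv Hw s t H1 H2 H3 H4 H5; subst u v.
  exists (fun z => h (Phi s) * phi z), (fun z => w * phi z),
    (h (Phi s) * (Phi t - Phi s)), (w * (Phi t - Phi s)).
  have Hst := HPhi s t H1 H2 H3.
  split; first exact: (is_RInt_scal phi).
  split; first exact: (is_RInt_scal phi).
  split; [ | split].
  + move=> z Hz.
    have P0 : 0 <= phi z by apply: Hpos; lra.
    have -> : h (Phi z) * phi z - h (Phi s) * phi z = (h (Phi z) - h (Phi s)) * phi z by ring.
    rewrite Rabs_mult (Rabs_pos_eq (phi z)) //; apply: Rmult_le_compat_r => //.
    have Hz' : Phi s <= Phi z <= Phi t by split; apply: mono; lra.
    have := Hw (Phi s) (Phi z) ltac:(lra) Hz'; have := Hw (Phi z) (Phi s) Hz' ltac:(lra).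
    rewrite /Rabs; case: Rcase_abs; lra.
  + lra.
  + have HI : is_RInt h (Phi s) (Phi t) (RInt h (Phi s) (Phi t)).
      apply: (RInt_correct h); apply: (ex_RInt_sub h _ _ _ _ Eh); lra.
    have HD := is_RInt_minus _ _ _ _ _ _ (is_RInt_const (Phi s) (Phi t) (h (Phi s))) HI.
    have := norm_RInt_le_const _ _ _ _ w Huv _ HD.
    rewrite /scal /= /mult /= (Rmult_comm (h (Phi s))) (Rmult_comm w); apply.
    move=> z Hz; have := Hw (Phi s) z ltac:(lra) Hz; have := Hw z (Phi s) Hz ltac:(lra).
    rewrite /norm /minus /plus /opp /= /abs /= /Rabs; case: Rcase_abs; lra.
- move=> u v w e e' Hu Huv Hvw Hw Q1 Q2 s t H1 H2 H3 H4 H5.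
  have [m [Hm Em]] := primitive_IVT s t v phi Phi H2
    (bounded_sub _ _ _ _ _ H1 H3 Hphi) (primitive_sub _ _ _ _ _ _ H1 H3 HPhi)
    ltac:(rewrite Rmin_left ?Rmax_right; lra).
  have <- : RInt h u v + RInt h v w = RInt h u w.
    apply: (RInt_Chasles h u v w); apply: (ex_RInt_sub h _ _ _ _ Eh); lra.
  apply: (approx_glue _ _ m); [lra | lra | apply: Q1 | apply: Q2] => //; lra.
Qed.

(** Integrability of h(Phi) against [Phi] gives a partition of [x, y] with a small
    oscillation sum. Since [Phi] maps each cell onto the interval between the
    images of its endpoints, [h] has the same oscillation there. *)
Lemma ex_RInt_comp_nondecreasing_inv (x y : R) (h phi Phi : R -> R) :
  x <= y -> bounded_on x y phi -> primitive_on x y phi Phi ->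
  bounded_on x y (fun t => h (Phi t)) ->
  (forall t, x <= t <= y -> 0 <= phi t) ->
  ex_RInt (fun t => h (Phi t) * phi t) x y -> ex_RInt h (Phi x) (Phi y).
Proof.
move=> Hxy Hphi HPhi Hh Hpos [A HA]; case: (Hh) => K HK.
have mono := primitive_nondecreasing x y phi Phi HPhi Hpos.
have Hle : Phi x <= Phi y by apply: mono; lra.
have HS := is_RInt_is_RSInt _ phi Phi x y A Hxy Hh Hphi HPhi HA.
apply: approx_ex_RInt => // eps He.
have [P [[t [EP [T1 T2]]] P2]] := HS (eps / 3) ltac:(lra).
have O : osc_sum (fun t => h (Phi t)) Phi P (2 * (eps / 3) + eps / 3).
  rewrite EP in T2 *; apply: (osc_sum_of_sums _ _ K) => //; last lra.
  - by rewrite T1.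
  - by rewrite T1.
  - have HPt p : SF_lx p = x :: t -> pointed_subdiv p ->
      Rabs (RS_sum (fun t => h (Phi t)) Phi p - A) <= eps / 3.
      move=> Ep Pp; apply: P2 => //; last by rewrite Ep EP; exact: incl_refl.
      by exists t; rewrite Ep -EP; split => //; split => //; rewrite EP.
    move=> p q Ep Eq Pp Pq; move: (HPt p Ep Pp) (HPt q Eq Pq).
    rewrite /Rabs; repeat case: Rcase_abs; lra.
rewrite EP in O T2; rewrite -T1.
have := osc_sum_cells _ _ x y (fun s t e => exists I, approx h (Phi s) (Phi t) I e) _ _ _ x t _ O _ _ T2.
have -> : 2 * (eps / 3) + eps / 3 = eps by field.
apply; try lra.
- by move=> s u e e' _ _ _ E [I HI]; exists I; apply: approx_weaken HI.
- move=> s u w Hs Hsu Hu Hw; exists (h (Phi s) * (Phi u - Phi s)).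
  apply: approx_const; last exact: mono.
  move=> z Hz.
  have [m [Hm <-]] := primitive_IVT s u z phi Phi Hsu
    (bounded_sub _ _ _ _ _ Hs Hu Hphi) (primitive_sub _ _ _ _ _ _ Hs Hu HPhi)
    ltac:(rewrite Rmin_left ?Rmax_right; lra).
  have := Hw s m ltac:(lra) Hm; have := Hw m s Hm ltac:(lra).
  rewrite /Rabs; case: Rcase_abs; lra.
- move=> s u v e e' Hs Hsu Huv Hv [I HI] [I' HI']; exists (I + I').
  by apply: (approx_glue _ _ (Phi u)) => //; apply: mono; lra.
Qed.

Lemma primitive_opp (c d : R) (g G : R -> R) :
  primitive_on c d g G -> primitive_on c d (fun x => - g x) (fun x => - G x).
Proof.
move=> H s t Hs Hst Ht; have := is_RInt_opp _ _ _ _ (H s t Hs Hst Ht).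
by rewrite /opp /= Ropp_minus_distr => HH; have -> : - G t - - G s = G s - G t by ring.
Qed.

Lemma bounded_opp (c d : R) (g : R -> R) :
  bounded_on c d g -> bounded_on c d (fun x => - g x).
Proof. by move=> [K HK]; exists K => x Hx; rewrite Rabs_Ropp; apply: HK. Qed.

(** The case phi <= 0 reduces to the other one by replacing [phi], [Phi] with their
    opposites and h with z |-> - h (- z), which leaves h(Phi) phi unchanged. *)
Lemma is_RInt_comp_monotone (x y : R) (h phi Phi : R -> R) (J : R) :
  x <= y -> bounded_on x y phi -> primitive_on x y phi Phi ->
  bounded_on x y (fun t => h (Phi t)) -> no_sign_change_on x y phi ->
  is_RInt h (Phi x) (Phi y) J -> is_RInt (fun t => h (Phi t) * phi t) x y J.
Proof.
move=> Hxy Hphi HPhi Hh [Hpos | Hneg] HJ; first exact: is_RInt_comp_nondecreasing.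
have HJ' : is_RInt (fun z => - h (- z)) (- Phi x) (- Phi y) J.
  by apply: (is_RInt_comp_opp h); rewrite !Ropp_involutive.
have := is_RInt_comp_nondecreasing x y (fun z => - h (- z)) (fun t => - phi t)
  (fun t => - Phi t) J Hxy (bounded_opp _ _ _ Hphi) (primitive_opp _ _ _ _ HPhi) _ _ HJ'.
move=> H; apply: is_RInt_ext; last apply: H.
- by move=> t _ /=; rewrite Ropp_involutive; ring.
- by apply: bounded_opp; case: Hh => K HK; exists K => t Ht; rewrite Ropp_involutive; apply: HK.
- by move=> t Ht; have := Hneg t Ht; lra.
Qed.

Lemma ex_RInt_comp_monotone_inv (x y : R) (h phi Phi : R -> R) :
  x <= y -> bounded_on x y phi -> primitive_on x y phi Phi ->
  bounded_on x y (fun t => h (Phi t)) -> no_sign_change_on x y phi ->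
  ex_RInt (fun t => h (Phi t) * phi t) x y -> ex_RInt h (Phi x) (Phi y).
Proof.
move=> Hxy Hphi HPhi Hh [Hpos | Hneg] HJ; first exact: (ex_RInt_comp_nondecreasing_inv x y h phi).
have [] := ex_RInt_comp_nondecreasing_inv x y (fun z => - h (- z)) (fun t => - phi t)
  (fun t => - Phi t) Hxy (bounded_opp _ _ _ Hphi) (primitive_opp _ _ _ _ HPhi).
- by apply: bounded_opp; case: Hh => K HK; exists K => t Ht; rewrite Ropp_involutive; apply: HK.
- by move=> t Ht; have := Hneg t Ht; lra.
- apply: ex_RInt_ext HJ => t _ /=; rewrite Ropp_involutive; ring.
move=> J HJ'; exists J.
apply: is_RInt_ext; last apply: (is_RInt_comp_opp _ _ _ _ HJ').
by move=> t _ /=; rewrite /opp /= !Ropp_involutive.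
Qed.

(** * Substitution for an arbitrary integrand *)

(** If [phi] takes a positive and a negative value, each of its values lies within
    [w] of a value of the opposite sign. *)
Lemma no_sign_change_or_small (phi : R -> R) (x y w : R) :
  osc_le phi x y w ->
  no_sign_change_on x y phi \/ forall t, x <= t <= y -> Rabs (phi t) <= w.
Proof.
move=> Hw.
case: (classic (no_sign_change_on x y phi)) => N; [by left | right => t Ht].
apply: Rabs_le; split.
- apply: Rnot_lt_le => C; apply: N; right => s Hs.
  by have := Hw s t Hs Ht; lra.
- apply: Rnot_lt_le => C; apply: N; left => s Hs.
  by have := Hw t s Ht Hs; lra.
Qed.

(** Kestelman's theorem. The error on a cell is bounded by [K + 1] times the
    oscillation of [phi] times the length, where [K] bounds h(Phi): on monotone
    cells there is no error at all, on the other ones both h(Phi) phi and the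
    integral of [h] over the image are that small. *)
Lemma is_RInt_comp_primitive (a b : R) (h phi Phi : R -> R) :
  a <= b -> bounded_on a b phi -> primitive_on a b phi Phi ->
  bounded_on a b (fun t => h (Phi t)) ->
  (forall s t, a <= s <= b -> a <= t <= b -> ex_RInt h (Phi s) (Phi t)) ->
  is_RInt (fun t => h (Phi t) * phi t) a b (RInt h (Phi a) (Phi b)).
Proof.
move=> Hab Hphi HPhi Hh Eh; case: (Hh) => K HK.
have K0 : 0 <= K by apply: Rle_trans (Rabs_pos _) (HK a _); lra.
apply: approx_is_RInt => // eps He.
pose Q x y e := approx (fun t => h (Phi t) * phi t) x y (RInt h (Phi x) (Phi y)) ((K + 1) * e).
have -> : eps = (K + 1) * (eps / (K + 1)) by field; lra.
apply: (RInt_cells phi a b Q) => //; last by apply: Rdiv_lt_0_compat; lra.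
- by exists (Phi b - Phi a); apply: HPhi; lra.
- move=> x y e e' _ _ _ E; apply: approx_weaken.
  by apply: Rmult_le_compat_l; lra.
- move=> x y w Hx Hxy Hy Hw.
  have w0 : 0 <= w by have := Hw x x ltac:(lra) ltac:(lra); lra.
  have wl0 : 0 <= w * (y - x) by apply: Rmult_le_pos; lra.
  have Bphi := bounded_sub _ _ _ _ _ Hx Hy Hphi.
  have PPhi := primitive_sub _ _ _ _ _ _ Hx Hy HPhi.
  have HI : is_RInt h (Phi x) (Phi y) (RInt h (Phi x) (Phi y)).
    by apply: (RInt_correct h); apply: Eh; lra.
  case: (no_sign_change_or_small phi x y w Hw) => [Hs | Hs].
    apply: (approx_weaken _ _ _ _ 0); first by apply: Rmult_le_pos; lra.
    apply: approx_exact; apply: is_RInt_comp_monotone => //.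
    exact: (bounded_sub a b).
  apply: (approx_weaken _ _ _ _ (K * w * (y - x))); first nra.
  (* Here |phi| <= w, so h(Phi) phi is enclosed by [- K w] and [K w]. *)
  exists (fun _ => 0), (fun _ => K * w), 0, (K * w * (y - x)).
  split; first by have := is_RInt_cst x y 0; rewrite Rmult_0_l.
  split; first exact: is_RInt_cst.
  split; [ | split].
  + move=> t Ht; rewrite Rminus_0_r Rabs_mult.
    by apply: Rmult_le_compat; try exact: Rabs_pos; [apply: HK; lra | apply: Hs].
  + lra.
  + rewrite Rminus_0_l Rabs_Ropp.
    have Bi := norm_RInt_le_const_abs h (Phi x) (Phi y) _ K _ HI.
    apply: Rle_trans (Bi _) _.
      move=> z Hz; apply: (bounded_between x y K h phi Phi) => // t Ht.
      by apply: HK; lra.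
    have := primitive_lipschitz x y w phi Phi PPhi Hs x y ltac:(lra) Hxy ltac:(lra).
    nra.
- move=> x y z e e' Hx Hxy Hyz Hz Q1 Q2.
  rewrite /Q Rmult_plus_distr_l.
  have <- : RInt h (Phi x) (Phi y) + RInt h (Phi y) (Phi z) = RInt h (Phi x) (Phi z).
    by apply: (RInt_Chasles h); apply: Eh; lra.
  exact: (approx_glue _ _ y).
Qed.

(** The theorem of Preiss and Uher. The property proved by induction over the cells
    of [a, b] is an enclosure of [h] on the image of the cell: exact where [Phi] is
    monotone, and by the constants [- K], [K] on the images of the other cells,
    which are short. Images of adjacent cells share a point but may overlap in any
    way, whence [approx_union]. *)
Lemma ex_RInt_comp_primitive_inv (a b c d : R) (h phi Phi : R -> R) :
  a <= b -> bounded_on a b phi -> primitive_on a b phi Phi ->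
  bounded_on a b (fun t => h (Phi t)) ->
  is_image Phi a b c d ->
  ex_RInt (fun t => h (Phi t) * phi t) a b -> ex_RInt h c d.
Proof.
move=> Hab Hphi HPhi Hh Him EH; case: (Hh) => K HK.
have K0 : 0 <= K by apply: Rle_trans (Rabs_pos _) (HK a _); lra.
have Hcd : c <= d.
  have : c <= Phi a <= d by apply/Him; exists a; split => //; lra.
  lra.
apply: approx_ex_RInt => // eps He.
pose Q x y e := exists p q, p <= q /\ is_image Phi x y p q /\
  exists I, approx h p q I ((K + 1) * e).
have : Q a b (eps / (K + 1)).
  apply: (RInt_cells phi a b Q) => //; last by apply: Rdiv_lt_0_compat; lra.
  - by exists (Phi b - Phi a); apply: HPhi; lra.
  - move=> x y e e' _ _ _ E [p [q [Hpq [Hi [I HI]]]]].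
    exists p, q; split => //; split => //; exists I; apply: approx_weaken HI.
    by apply: Rmult_le_compat_l; lra.
  - move=> x y w Hx Hxy Hy Hw.
    have w0 : 0 <= w by have := Hw x x ltac:(lra) ltac:(lra); lra.
    have wl0 : 0 <= w * (y - x) by apply: Rmult_le_pos; lra.
    have Bphi := bounded_sub _ _ _ _ _ Hx Hy Hphi.
    have PPhi := primitive_sub _ _ _ _ _ _ Hx Hy HPhi.
    have Bh := bounded_sub _ _ _ _ _ Hx Hy Hh.
    have [p [q [Hpq Hi]]] := primitive_image x y phi Phi Hxy Bphi PPhi.
    exists p, q; split => //; split => //.
    have [s [Hs Es]] := proj1 (Hi p) ltac:(lra).
    have [t [Ht Et]] := proj1 (Hi q) ltac:(lra).
    case: (no_sign_change_or_small phi x y w Hw) => [Hsg | Hsm].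
      have Hx' : p <= Phi x <= q by apply/Hi; exists x; split => //; lra.
      have Hy' : p <= Phi y <= q by apply/Hi; exists y; split => //; lra.
      have E : ex_RInt h (Phi x) (Phi y).
        apply: (ex_RInt_comp_monotone_inv x y h phi) => //.
        apply: (ex_RInt_sub _ _ _ _ _ EH); lra.
      (* By monotonicity the image is the interval between [Phi x] and [Phi y]. *)
      have {E} [I HI] : ex_RInt h p q.
        case: Hsg => Hsg.
          have mono := primitive_nondecreasing x y phi Phi PPhi Hsg.
          have := mono x s ltac:(lra) ltac:(lra) ltac:(lra).
          have := mono t y ltac:(lra) ltac:(lra) ltac:(lra).
          rewrite Es Et => L1 L2.
          have -> : p = Phi x by lra.
          by have -> : q = Phi y by lra.
        have mono := primitive_nondecreasing x y (fun x => - phi x) (fun x => - Phi x)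
          (primitive_opp _ _ _ _ PPhi) ltac:(move=> z /Hsg; lra).
        have := mono x t ltac:(lra) ltac:(lra) ltac:(lra).
        have := mono s y ltac:(lra) ltac:(lra) ltac:(lra).
        rewrite Es Et => L1 L2; apply: ex_RInt_swap.
        have -> : p = Phi y by lra.
        by have -> : q = Phi x by lra.
      exists I; apply: (approx_weaken _ _ _ _ 0); first by apply: Rmult_le_pos; lra.
      exact: approx_exact.
    exists (0 * (q - p)); apply: (approx_weaken _ _ _ _ (K * (q - p))); last first.
      apply: approx_const => // z /Hi [u [Hu <-]]; rewrite Rminus_0_r.
      by apply: HK; lra.
    have : q - p <= w * (y - x).
      rewrite -Es -Et.
      have L := primitive_lipschitz x y w phi Phi PPhi Hsm.
      apply: Rle_trans (Rle_abs _) _.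
      case: (Rle_dec s t) => C.
        apply: Rle_trans (L s t _ C _) _; try lra.
        by apply: Rmult_le_compat_l; lra.
      rewrite Rabs_minus_sym; apply: Rle_trans (L t s _ _ _) _; try lra.
      by apply: Rmult_le_compat_l; lra.
    nra.
  - move=> x y z e e' Hx Hxy Hyz Hz [p [q [Hpq [Hi Ha]]]] [p' [q' [Hpq' [Hi' Ha']]]].
    have M1 : p <= Phi y <= q by apply/Hi; exists y; split => //; lra.
    have M2 : p' <= Phi y <= q' by apply/Hi'; exists y; split => //; lra.
    exists (Rmin p p'), (Rmax q q'); split; last split.
    + have := Rmin_l p p'; have := Rmax_l q q'; lra.
    + move=> v; split.
        move=> Hv; case: (classic (p <= v <= q)) => [/Hi [u [Hu Eu]] | N].
          by exists u; split => //; lra.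
        have /Hi' [u [Hu Eu]] : p' <= v <= q'.
          by move: Hv; rewrite /Rmin /Rmax; repeat case: Rle_dec; lra.
        by exists u; split => //; lra.
      move=> [u [Hu Eu]].
      have := Rmin_l p p'; have := Rmin_r p p'; have := Rmax_l q q'; have := Rmax_r q q'.
      case: (Rle_dec u y) => C.
        have : p <= v <= q by apply/Hi; exists u; split => //; lra.
        lra.
      have : p' <= v <= q' by apply/Hi'; exists u; split => //; lra.
      lra.
    + rewrite Rmult_plus_distr_l; apply: approx_union => //; lra.
move=> [p [q [Hpq [Hi]]]].
have -> : (K + 1) * (eps / (K + 1)) = eps by field; lra.
move=> Ha.
have C1 : p <= c <= q by apply/Hi; apply/Him; lra.
have C2 : p <= d <= q by apply/Hi; apply/Him; lra.
have C3 : c <= p <= d by apply/Him; apply/Hi; lra.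
have C4 : c <= q <= d by apply/Him; apply/Hi; lra.
have <- : p = c by lra.
by have <- : q = d by lra.
Qed.

(** * Change of variable for integrals against indefinite integrals *)

Theorem mainTheorem2 :
  forall (a b : R) (phi Phi : R -> R),
    a <= b ->
    bounded_on a b phi ->
    ex_RInt phi a b ->
    indefinite_integral a b a phi Phi ->
  forall c d : R,
    (* [c, d] = Phi(I) *)
    (forall y : R, c <= y <= d <-> exists x : R, a <= x <= b /\ Phi x = y) ->
  forall psi Psi : R -> R,
    bounded_on c d psi ->
    ex_RInt psi c d ->
    no_sign_change_on c d psi ->
    indefinite_integral c d (Phi a) psi Psi ->
  forall f : R -> R,
    bounded_on c d f ->
    (ex_RSInt f Psi c d <->
     ex_RSInt (fun x : R => f (Phi x) * psi (Phi x)) Phi a b) /\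
    (ex_RSInt f Psi c d ->
     exists A : R,
       is_RSInt_oriented f Psi (Phi a) (Phi b) A /\
       is_RSInt (fun x : R => f (Phi x) * psi (Phi x)) Phi a b A).
Proof.
move=> a b phi Phi Hab Bphi Ephi IPhi c d Him psi Psi Bpsi Epsi _ IPsi f Bf.
have Phi_in x : a <= x <= b -> c <= Phi x <= d.
  by move=> Hx; apply/Him; exists x.
have Ha : c <= Phi a <= d by apply: Phi_in; lra.
have Hb : c <= Phi b <= d by apply: Phi_in; lra.
have Hcd : c <= d by lra.
have PPhi : primitive_on a b phi Phi.
  by apply: (indefinite_integral_primitive a b a) => //; lra.
have PPsi : primitive_on c d psi Psi.
  exact: (indefinite_integral_primitive c d (Phi a)).
pose h y := f y * psi y.
have Bh : bounded_on a b (fun x => h (Phi x)).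
  case: Bf => K HK; case: Bpsi => M HM; exists (K * M) => x /Phi_in Hx.
  rewrite Rabs_mult; apply: Rmult_le_compat; try exact: Rabs_pos; [exact: HK | exact: HM].
have comp : ex_RSInt f Psi c d ->
    is_RInt (fun x => h (Phi x) * phi x) a b (RInt h (Phi a) (Phi b)).
  move=> /(ex_RSInt_ex_RInt f psi Psi c d Hcd Bf Bpsi PPsi) Eh.
  apply: (is_RInt_comp_primitive a b) => // s t Hs Ht.
  by apply: (ex_RInt_sub h c d) => //; apply: Phi_in.
have value : ex_RSInt f Psi c d ->
    is_RSInt (fun x => h (Phi x)) Phi a b (RInt h (Phi a) (Phi b)).
  by move=> /comp; apply: (is_RInt_is_RSInt _ phi).
split; first split.
- by move=> /value; exists (RInt h (Phi a) (Phi b)).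
- move=> /(ex_RSInt_ex_RInt _ phi Phi a b Hab Bh Bphi PPhi) EH.
  have [A HA] := ex_RInt_comp_primitive_inv a b c d h phi Phi Hab Bphi PPhi Bh Him EH.
  by exists A; apply: (is_RInt_is_RSInt f psi).
move=> Ef; exists (RInt h (Phi a) (Phi b)); split; last exact: value.
have Eh := ex_RSInt_ex_RInt f psi Psi c d Hcd Bf Bpsi PPsi Ef.
have HJ : is_RInt h (Phi a) (Phi b) (RInt h (Phi a) (Phi b)).
  by apply: (RInt_correct h); apply: (ex_RInt_sub h c d).
have sub s t J : c <= s -> s <= t -> t <= d -> is_RInt h s t J -> is_RSInt f Psi s t J.
  move=> Hs Hst Ht; apply: (is_RInt_is_RSInt f psi) => //.
  - exact: (bounded_sub c d).
  - exact: (bounded_sub c d).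
  - exact: (primitive_sub c d).
case: (Rle_dec (Phi a) (Phi b)) => C; [left | right]; split; try lra.
- by apply: sub => //; lra.
- apply: sub; try lra.
  exact: (is_RInt_swap h).
Qed.
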